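(* Let $\mathsf{Pred}$ be a finite set of unary predicates, $S_1,\dots,S_n$ pairwise distinct state-descriptions over $\mathsf{Pred}$, and $\mathcal{V}\subseteq\mathbb{N}^n$. Then there is an $\mathcal{L}^1_\sharp$ sentence $\varphi$ in the predicates $\mathsf{Pred}$ such that for every finite model $\mathcal{M}$, $\mathcal{M}\models\varphi$ iff $(|S_1|_\mathcal{M},\dots,|S_n|_\mathcal{M})\in\mathcal{V}$, if and only if $\mathcal{V}$ is the set of solutions in $\mathbb{N}^n$ of some Boolean combination of Diophantine inequalities in variables $\mathsf{v}_1,\dots,\mathsf{v}_n$. That is, the definable sets of $\mathsf{MFO}^\phi(\sharp)$ are exactly those definable by Boolean combinations of Diophantine inequalities.
   Context: $\mathcal{L}^1_\sharp$ is monadic first-order logic with equality over unary predicates, closed under Booleans, first-order quantifiers and polyadic count comparisons $\sharp_{\mathbf{x}}\varphi\succsim\sharp_{\mathbf{y}}\psi$ for finite sequences of variables $\mathbf{x}=x_1,\dots,x_k$, $\mathbf{y}=y_1,\dots,y_l$ (arbitrarily nested), true in a model with domain $D$ iff $|\{\mathbf{d}\in D^k:\varphi\text{ holds with }\mathbf{x}\mapsto\mathbf{d}\}|\ge|\{\mathbf{d}\in D^l:\psi\text{ holds with }\mathbf{y}\mapsto\mathbf{d}\}|$. $\mathsf{MFO}^\phi(\sharp)$ is this logic over finite models. A state-description over $\mathsf{Pred}$ is $\bigwedge_{P\in J}P(x)\wedge\bigwedge_{P\notin J}\neg P(x)$, $J\subseteq\mathsf{Pred}$; $|S|_\mathcal{M}$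 is the cardinality of its extension. A Diophantine inequality is $m_1(\mathbf{v})+\dots+m_k(\mathbf{v})\ge m'_1(\mathbf{v})+\dots+m'_j(\mathbf{v})$ where each $m_i,m'_i$ is a monomial $a\,\mathsf{v}_1^{e_1}\cdots\mathsf{v}_n^{e_n}$ with natural numbers $a>0$, $e_1,\dots,e_n$. *)

(* Defs.v *)
From HB Require Import structures.
From mathcomp Require Import all_boot.

Set Implicit Arguments.
Unset Strict Implicit.
Unset Printing Implicit Defensive.

(* Variables are natural numbers. The sequences bound by a counting operator
   are nonempty and consist of distinct variables, so that the assignment
   x |-> d of a tuple of objects is unambiguous. *)
Record varseq : Type := VarSeq {
  vars :> seq nat;
  vars_uniq : uniq vars;
  vars_gt0 : 0 < size vars
}.

(* [FCount x phi y psi] is the comparison  #_x phi >= #_y psi. *)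
Inductive formula (Pred : Type) : Type :=
| FTop
| FPred of Pred & nat
| FEq of nat & nat
| FNot of formula Pred
| FAnd of formula Pred & formula Pred
| FOr of formula Pred & formula Pred
| FEx of nat & formula Pred
| FAll of nat & formula Pred
| FCount of varseq & formula Pred & varseq & formula Pred.

Arguments FTop {Pred}.
Arguments FEq {Pred}.

Fixpoint fv (Pred : Type) (phi : formula Pred) : seq nat :=
  match phi with
  | FTop => [::]
  | FPred _ x => [:: x]
  | FEq x y => [:: x; y]
  | FNot a => fv a
  | FAnd a b | FOr a b => fv a ++ fv b
  | FEx x a | FAll x a => [seq z <- fv a | z != x]
  | FCount x a y b =>
      [seq z <- fv a | z \notin vars x] ++ [seq z <- fv b | z \notin vars y]
  end.

Definition sentence (Pred : Type) (phi : formula Pred) : bool := nilp (fv phi).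

(* As usual in first-order logic, domains are nonempty. *)
Record finmodel (Pred : Type) : Type := FinModel {
  dom :> finType;
  dom_gt0 : 0 < #|dom|;
  interp : Pred -> {set dom}
}.

(* Simultaneous update; a variable z outside x has [index z x = size x],
   hence falls through to the default value [g z]. *)
Definition upd (T : Type) (g : nat -> T) (x : seq nat) (d : seq T) : nat -> T :=
  fun z => nth (g z) d (index z x).

Fixpoint eval (Pred : Type) (M : finmodel Pred) (phi : formula Pred)
    (g : nat -> M) : bool :=
  match phi with
  | FTop => true
  | FPred P x => g x \in interp M P
  | FEq x y => g x == g y
  | FNot a => ~~ eval a g
  | FAnd a b => eval a g && eval b g
  | FOr a b => eval a g || eval b g
  | FEx x a => [exists d : M, eval a (upd g [:: x] [:: d])]
  | FAll x a => [forall d : M, eval a (upd g [:: x] [:: d])]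
  | FCount x a y b =>
      #|[set d : (size x).-tuple M | eval a (upd g x d)]|
        >= #|[set d : (size y).-tuple M | eval b (upd g y d)]|
  end.

Definition models (Pred : Type) (M : finmodel Pred) (phi : formula Pred) : Prop :=
  forall g : nat -> M, eval phi g.

(* The state-description over Pred given by J, with the variable x taken to
   be 0; distinct sets J give distinct state-descriptions. *)
Definition state_desc (Pred : finType) (J : {set Pred}) : formula Pred :=
  FAnd (\big[@FAnd Pred/FTop]_(P in J) FPred P 0)
       (\big[@FAnd Pred/FTop]_(P in ~: J) FNot (FPred P 0)).

Definition state_card (Pred : finType) (M : finmodel Pred) (J : {set Pred}) : nat :=
  #|[set d : M | eval (state_desc J) (fun=> d)]|.

Record monomial (n : nat) : Type := Monomial {
  coef : nat;
  coef_gt0 : 0 < coef;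
  expo : {ffun 'I_n -> nat}
}.

Definition monomial_eval (n : nat) (v : {ffun 'I_n -> nat}) (m : monomial n) : nat :=
  coef m * \prod_(i < n) v i ^ expo m i.

Record dioph_ineq (n : nat) : Type := DiophIneq {
  lhs : seq (monomial n);
  rhs : seq (monomial n);
  lhs_gt0 : 0 < size lhs;
  rhs_gt0 : 0 < size rhs
}.

Definition dioph_holds (n : nat) (v : {ffun 'I_n -> nat}) (e : dioph_ineq n) : bool :=
  \sum_(m <- lhs e) monomial_eval v m >= \sum_(m <- rhs e) monomial_eval v m.

Inductive bool_dioph (n : nat) : Type :=
| BIneq of dioph_ineq n
| BNot of bool_dioph n
| BAnd of bool_dioph n & bool_dioph n
| BOr of bool_dioph n & bool_dioph n.

Fixpoint solution (n : nat) (b : bool_dioph n) (v : {ffun 'I_n -> nat}) : bool :=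
  match b with
  | BIneq e => dioph_holds v e
  | BNot a => ~~ solution a v
  | BAnd a c => solution a v && solution c v
  | BOr a c => solution a v || solution c v
  end.

(* Main.v *)
(** From sentences to inequalities: over models whose elements all have one of
    the types S_i, the number of witnesses of a formula with k bound variables,
    as a function of v and of the equality and type pattern of the parameters,
    is a piecewise polynomial with integer coefficients, the pieces being cut
    out by Boolean combinations of Diophantine inequalities.  Counting is done
    one variable at a time: the bound object is either a parameter, or one of
    the v_J - c_J fresh objects of type J, where c_J parameters have type J.
    The models considered realise every v except v = 0, which is adjusted by
    hand since {0} is itself definable.

    From inequalities to sentences: two distinct parameters c0, c1 serve as
    tags for disjoint unions, so that each sum of monomials is the number of
    tuples satisfying some formula in c0, c1.  Domains with one element do not
    provide such parameters, but there v is determined by the type of that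
    element, and a finite disjunction of state-descriptions suffices. *)

Require Import Defs.
From mathcomp Require Import all_boot all_algebra zify boolp.

Set Implicit Arguments.
Unset Strict Implicit.
Unset Printing Implicit Defensive.

Import GRing.Theory Num.Theory.

(** * Piecewise polynomial functions *)

Definition poly_eval (n : nat) (p : seq (monomial n)) (v : {ffun 'I_n -> nat}) :=
  \sum_(m <- p) monomial_eval v m.

(** Monomials have positive coefficients, so an integer polynomial is a difference of two sums of
    monomials; the empty sum is allowed here and gives 0. *)
Definition polynomial (n : nat) (f : {ffun 'I_n -> nat} -> int) : Prop :=
  exists p q, forall v, f v = (Posz (poly_eval p v) - Posz (poly_eval q v))%R.

Definition mono1 (n : nat) : monomial n :=
  @Monomial n 1 isT [ffun=> 0].

Definition monoX (n : nat) (i : 'I_n) : monomial n :=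
  @Monomial n 1 isT [ffun j => (j == i) : nat].

Lemma monoM_coef_gt0 (n : nat) (m1 m2 : monomial n) : 0 < coef m1 * coef m2.
Proof. by rewrite muln_gt0 !coef_gt0. Qed.

Definition monoM (n : nat) (m1 m2 : monomial n) : monomial n :=
  Monomial (monoM_coef_gt0 m1 m2) [ffun i => expo m1 i + expo m2 i].

Lemma mono1E n (v : {ffun 'I_n -> nat}) : monomial_eval v (mono1 n) = 1.
Proof.
by rewrite /monomial_eval mul1n big1 // => i _; rewrite ffunE expn0.
Qed.

Lemma monoXE n (v : {ffun 'I_n -> nat}) i : monomial_eval v (monoX i) = v i.
Proof.
rewrite /monomial_eval mul1n (bigD1 i) //= ffunE eqxx expn1 big1 ?muln1 //.
by move=> j /negPf ji; rewrite ffunE ji.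
Qed.

Lemma monoME n (v : {ffun 'I_n -> nat}) m1 m2 :
  monomial_eval v (monoM m1 m2) = monomial_eval v m1 * monomial_eval v m2.
Proof.
rewrite /monomial_eval /= mulnACA -big_split /=; congr (_ * _).
by apply: eq_bigr => i _; rewrite ffunE expnD.
Qed.

Lemma poly_eval_cat n p q (v : {ffun 'I_n -> nat}) :
  poly_eval (p ++ q) v = poly_eval p v + poly_eval q v.
Proof. by rewrite /poly_eval big_cat. Qed.

Lemma poly_evalM n p q (v : {ffun 'I_n -> nat}) :
  poly_eval [seq monoM a b | a <- p, b <- q] v = poly_eval p v * poly_eval q v.
Proof.
rewrite /poly_eval big_allpairs_dep big_distrl /=; apply: eq_bigr => a _.
by rewrite big_distrr; apply: eq_bigr => b _; rewrite monoME.
Qed.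

Lemma polynomial_nat n k : polynomial (fun _ : {ffun 'I_n -> nat} => Posz k).
Proof.
exists (nseq k (mono1 n)), [::] => v.
by rewrite /poly_eval big_nil subr0 big_nseq mono1E iter_addn_0 mul1n.
Qed.

Lemma polynomialX n (i : 'I_n) :
  polynomial (fun v : {ffun 'I_n -> nat} => Posz (v i)).
Proof.
by exists [:: monoX i], [::] => v; rewrite /poly_eval big_nil big_seq1 subr0 monoXE.
Qed.

Lemma polynomialD n (f g : {ffun 'I_n -> nat} -> int) :
  polynomial f -> polynomial g -> polynomial (fun v => (f v + g v)%R).
Proof.
move=> [p [q fE]] [p' [q' gE]]; exists (p ++ p'), (q ++ q') => v.
by rewrite fE gE !poly_eval_cat; lia.
Qed.

Lemma polynomialN n (f : {ffun 'I_n -> nat} -> int) :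
  polynomial f -> polynomial (fun v => (- f v)%R).
Proof. by move=> [p [q fE]]; exists q, p => v; rewrite fE opprB. Qed.

Lemma polynomialM n (f g : {ffun 'I_n -> nat} -> int) :
  polynomial f -> polynomial g -> polynomial (fun v => (f v * g v)%R).
Proof.
move=> [p [q fE]] [p' [q' gE]].
pose M := fun r s : seq (monomial n) => [seq monoM a b | a <- r, b <- s].
exists (M p p' ++ M q q'), (M p q' ++ M q p') => v.
by rewrite fE gE !poly_eval_cat !poly_evalM; lia.
Qed.

Lemma polynomial_ge0 n (f : {ffun 'I_n -> nat} -> int) : polynomial f ->
  exists b : bool_dioph n, forall v, solution b v = (0 <= f v)%R.
Proof.
move=> [p [q fE]].
(* Both sides of an inequality must be nonempty, hence the constant monomial 1 added to each; the
   comparison is unaffected. *)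
exists (BIneq (@DiophIneq n (mono1 n :: p) (mono1 n :: q) isT isT)) => v.
rewrite fE /= /dioph_holds /= !big_cons !mono1E -!/(poly_eval _ _); lia.
Qed.

(** A finite decision tree: conditions at the nodes, polynomials at the leaves. *)
Inductive piecewise (n : nat) : ({ffun 'I_n -> nat} -> int) -> Prop :=
| PiecewisePoly f : polynomial f -> piecewise f
| PiecewiseIf b f g h : piecewise f -> piecewise g ->
    (forall v, h v = if solution b v then f v else g v) -> piecewise h.

(** The second tree is grafted onto every leaf of the first, so that [op] is only needed on pairs of
    polynomials. *)
Lemma piecewise_map2 n (op : int -> int -> int) :
  (forall f g : {ffun 'I_n -> nat} -> int,
     polynomial f -> polynomial g -> piecewise (fun v => op (f v) (g v))) ->
  forall f g : {ffun 'I_n -> nat} -> int,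
    piecewise f -> piecewise g -> piecewise (fun v => op (f v) (g v)).
Proof.
move=> opP f g pf; elim: pf g => {f} [f pf|b f f' h _ IHf _ IHf' hE] g pg.
  elim: pg => {g} [g|b g g' h _ IHg _ IHg' hE]; first exact: opP.
  by apply: (PiecewiseIf (b := b) IHg IHg') => v; rewrite hE; case: ifP.
apply: (PiecewiseIf (b := b) (IHf g pg) (IHf' g pg)) => v.
by rewrite hE; case: ifP.
Qed.

Lemma piecewiseD n (f g : {ffun 'I_n -> nat} -> int) :
  piecewise f -> piecewise g -> piecewise (fun v => (f v + g v)%R).
Proof.
apply: piecewise_map2 => {f g} f g pf pg.
by apply: PiecewisePoly; apply: polynomialD.
Qed.

Lemma piecewiseM n (f g : {ffun 'I_n -> nat} -> int) :
  piecewise f -> piecewise g -> piecewise (fun v => (f v * g v)%R).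
Proof.
apply: piecewise_map2 => {f g} f g pf pg.
by apply: PiecewisePoly; apply: polynomialM.
Qed.

Lemma piecewise_nat n k : piecewise (fun _ : {ffun 'I_n -> nat} => Posz k).
Proof. by apply: PiecewisePoly; apply: polynomial_nat. Qed.

Lemma piecewiseB n (f g : {ffun 'I_n -> nat} -> int) :
  piecewise f -> piecewise g -> piecewise (fun v => (f v - g v)%R).
Proof.
move=> pf; apply: (piecewise_map2 (op := fun x y => (x - y)%R)) => // f' g' pf' pg'.
by apply: PiecewisePoly; apply: polynomialD => //; apply: polynomialN.
Qed.

Lemma piecewise_sum n (I : Type) (r : seq I) (P : pred I)
    (F : I -> {ffun 'I_n -> nat} -> int) :
  (forall i, piecewise (F i)) -> piecewise (fun v => (\sum_(i <- r | P i) F i v)%R).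
Proof.
move=> pF; elim: r => [|i r IHr].
  by under eq_fun do rewrite big_nil; exact: (piecewise_nat n 0).
under eq_fun do rewrite big_cons; case: (P i) => //.
exact: piecewiseD.
Qed.

Lemma piecewise_ge0 n (f : {ffun 'I_n -> nat} -> int) : piecewise f ->
  exists b : bool_dioph n, forall v, solution b v = (0 <= f v)%R.
Proof.
elim=> {f} [f|b f g h _ [bf bfE] _ [bg bgE] hE]; first exact: polynomial_ge0.
exists (BOr (BAnd b bf) (BAnd (BNot b) bg)) => v /=.
by rewrite hE bfE bgE; case: (solution b v); rewrite ?orbF.
Qed.

(** A comparison becomes a function with values 0 and 1, so that truth values can be summed in turn;
    this is what handles nested counting. *)
Lemma piecewise_le n (f g : {ffun 'I_n -> nat} -> int) :
  piecewise f -> piecewise g -> piecewise (fun v => Posz (f v <= g v)%R).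
Proof.
move=> pf pg; have [b bE] := piecewise_ge0 (piecewiseB pg pf).
apply: (PiecewiseIf (b := b) (piecewise_nat n 1) (piecewise_nat n 0)) => v.
by rewrite bE subr_ge0; case: (_ <= _)%R.
Qed.

(** * Types of objects and iterated counting *)

Definition obj_type (Pred : finType) (M : finmodel Pred) (d : M) : {set Pred} :=
  [set P | d \in interp M P].

Definition type_at (Pred : finType) (J : {set Pred}) (z : nat) : formula Pred :=
  FAnd (\big[@FAnd Pred/FTop]_(P in J) FPred P z)
       (\big[@FAnd Pred/FTop]_(P in ~: J) FNot (FPred P z)).

Lemma eval_type_at (Pred : finType) (M : finmodel Pred) (g : nat -> M) J z :
  eval (type_at J z) g = (obj_type (g z) == J).
Proof.
have bigE (A : {set Pred}) F : eval (\big[@FAnd Pred/FTop]_(P in A) F P) g =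
    [forall (P | P \in A), eval (F P) g].
  by rewrite (big_morph (fun a => eval a g) (id1 := true) (op1 := andb)) // big_andE.
rewrite /= !bigE /=; apply/andP/eqP => [[/forall_inP h1 /forall_inP h2]|<-].
  apply/setP => P; rewrite inE; apply/idP/idP => [|/h1 //].
  by apply: contraTT => PJ; apply: h2; rewrite inE.
by split; apply/forall_inP => P; rewrite !inE.
Qed.

Lemma state_cardE (Pred : finType) (M : finmodel Pred) J :
  state_card M J = #|[set d : M | obj_type d == J]|.
Proof.
by apply: eq_card => d; rewrite !inE -(eval_type_at (fun=> d) J 0).
Qed.

Definition tuple_count (Pred : Type) (M : finmodel Pred) (x : seq nat) (a : formula Pred)
    (g : nat -> M) : nat :=
  #|[set d : (size x).-tuple M | eval a (upd g x d)]|.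

Lemma updE (T : Type) (g : nat -> T) z d y :
  upd g [:: z] [:: d] y = if y == z then d else g y.
Proof. by rewrite /upd /= [z == y]eq_sym; case: (y == z). Qed.

(** As [z] does not occur in [x], the two updates do not interfere. *)
Lemma upd_cons (T : Type) (g : nat -> T) z x d (t : seq T) :
  z \notin x -> size t = size x ->
  upd g (z :: x) (d :: t) = upd (upd g [:: z] [:: d]) x t.
Proof.
move=> zx st; apply: funext => y; rewrite /upd -/(upd g [:: z] [:: d] y) updE /=.
rewrite [z == y]eq_sym; case: eqP => [->|//] /=.
by rewrite nth_default // st (memNindex zx).
Qed.

Lemma tuple_count_nil (Pred : Type) (M : finmodel Pred) a (g : nat -> M) :
  tuple_count [::] a g = eval a g.
Proof.
have -> : tuple_count [::] a g = #|[set _ : 0.-tuple M | eval a g]|.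
  apply: eq_card => d; rewrite !inE; congr (eval a _).
  by apply: funext => z; rewrite /upd tuple0.
case: (eval a g); last by rewrite (eq_card0 (fun _ => _)) // => d; rewrite inE.
by rewrite cardsE cardT -cardE card_tuple expn0.
Qed.

Lemma tuple_count_cons (Pred : Type) (M : finmodel Pred) z x a (g : nat -> M) :
  z \notin x ->
  tuple_count (z :: x) a g = \sum_(d : M) tuple_count x a (upd g [:: z] [:: d]).
Proof.
move=> zx; rewrite /tuple_count -sum1dep_card big_mkcond /=.
rewrite (reindex (fun p : M * (size x).-tuple M => [tuple of p.1 :: p.2])) /=; last first.
  exists (fun t => (thead t, [tuple of behead t])) => [[d t] _|t _] /=.
    by congr (_, _); apply: val_inj.
  by rewrite -tuple_eta.
rewrite -(pair_bigA _ (fun d (t : (size x).-tuple M) =>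
   if eval a (upd g (z :: x) (d :: t)) then 1 else 0)) /=.
apply: eq_bigr => d _; rewrite -sum1dep_card [RHS]big_mkcond /=.
by apply: eq_bigr => t _; rewrite upd_cons // size_tuple.
Qed.

(** * Counting functions are piecewise polynomial *)

(** A type outside the range of [S] gets the empty sum, so no object of [M] has it. *)
Definition profile (Pred : finType) (n : nat) (S : 'I_n -> {set Pred})
    (v : {ffun 'I_n -> nat}) (M : finmodel Pred) : Prop :=
  forall J, state_card M J = \sum_(i | S i == J) v i.

Definition compatible (Pred : finType) (M : finmodel Pred) (X : seq nat)
    (R : rel nat) (K : nat -> {set Pred}) (g : nat -> M) : Prop :=
  {in X &, forall y z, (g y == g z) = R y z} /\
  {in X, forall y, obj_type (g y) = K y}.

(* R and K prescribe the equalities among the values of the variables in X and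
   their types; the condition is vacuous if no assignment realises them. *)
Definition definable (Pred : finType) (n : nat) (S : 'I_n -> {set Pred})
    (X : seq nat) (f : forall M : finmodel Pred, (nat -> M) -> int) : Prop :=
  forall (R : rel nat) (K : nat -> {set Pred}),
    exists P, piecewise P /\
    forall v (M : finmodel Pred) (g : nat -> M),
      profile S v M -> compatible X R K g -> f M g = P v.

(* One variable per value: the last one in X among those identified by R. *)
Fixpoint reps (R : rel nat) (X : seq nat) : seq nat :=
  if X is y :: X' then
    if has (R y) X' then reps R X' else y :: reps R X'
  else [::].

Lemma reps_subset R X : {subset reps R X <= X}.
Proof.
elim: X => //= y X IHX z; case: ifP => _; rewrite ?inE.
  by move/IHX ->; rewrite orbT.
by case/orP => [->//|/IHX ->]; rewrite orbT.
Qed.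

(** [undup] keeps the last occurrence of each value, just as [reps] keeps the last variable of each
    class. *)
Lemma undup_map_reps (Pred : finType) (M : finmodel Pred) X R K (g : nat -> M) :
  compatible X R K g -> undup (map g X) = map g (reps R X).
Proof.
case=> gR _; elim: X gR => //= y X IHX gR.
have -> : (g y \in map g X) = has (R y) X.
  apply/mapP/hasP => -[z zX e]; exists z => //.
    by rewrite -gR ?inE ?eqxx ?zX ?orbT // e.
  by apply/eqP; rewrite gR ?inE ?eqxx ?zX ?orbT.
rewrite IHX; first by case: ifP.
by move=> a b aX bX; apply: gR; rewrite inE ?aX ?bX orbT.
Qed.

Lemma definable_mono (Pred : finType) n (S : 'I_n -> {set Pred}) X Y f :
  {subset X <= Y} -> definable S X f -> definable S Y f.
Proof.
move=> XY df R K; have [P [pP fP]] := df R K; exists P; split=> // v M g pr [gR gK].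
apply: fP => //; split; first by move=> a b /XY aY /XY bY; apply: gR.
by move=> a /XY; apply: gK.
Qed.

Lemma definable_map2 (Pred : finType) n (S : 'I_n -> {set Pred}) X f1 f2
    (op : int -> int -> int) :
  (forall P Q : {ffun 'I_n -> nat} -> int,
     piecewise P -> piecewise Q -> piecewise (fun v => op (P v) (Q v))) ->
  definable S X f1 -> definable S X f2 ->
  definable S X (fun M g => op (f1 M g) (f2 M g)).
Proof.
move=> opP d1 d2 R K; have [P1 [pP1 E1]] := d1 R K; have [P2 [pP2 E2]] := d2 R K.
exists (fun v => op (P1 v) (P2 v)); split; first exact: opP.
by move=> v M g pr co; rewrite (E1 v) // (E2 v).
Qed.

(** * Summation over one bound variable *)

Definition redirect (z y a : nat) : nat := if a == z then y else a.

(** If [z] takes the value of a parameter [y], the new pattern is the old one pulled back along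
    [redirect z y], hence independent of the model. *)
Lemma compatible_old (Pred : finType) (M : finmodel Pred) X R K (g : nat -> M) z y :
  y \in X -> compatible X R K g ->
  compatible (z :: X) (fun a b => R (redirect z y a) (redirect z y b))
    (K \o redirect z y) (upd g [:: z] [:: g y]).
Proof.
move=> yX [gR gK]; pose r := redirect z y; rewrite -/r.
have rX a : a \in z :: X -> r a \in X.
  by rewrite inE /r /redirect; case: eqP.
have updr a : upd g [:: z] [:: g y] a = g (r a) by rewrite updE /r /redirect; case: eqP.
split; first by move=> a b /rX aX /rX bX; rewrite !updr gR.
by move=> a /rX aX; rewrite updr gK.
Qed.

(** A fresh object differs from every parameter, so its type alone determines the extended
    pattern. *)
Lemma compatible_new (Pred : finType) (M : finmodel Pred) X R K (g : nat -> M) z d :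
  d \notin map g X -> compatible X R K g ->
  compatible (z :: X)
    (fun a b => if a == z then b == z else if b == z then false else R a b)
    (fun a => if a == z then obj_type d else K a)
    (upd g [:: z] [:: d]).
Proof.
move=> dX [gR gK]; split=> [a b|a]; rewrite !inE !updE.
  case: (eqVneq a z) => /= _ aX; case: (eqVneq b z) => /= _ bX.
  - exact: eqxx.
  - by apply: contraNF dX => /eqP ->; apply: map_f.
  - by apply: contraNF dX => /eqP <-; apply: map_f.
  - exact: gR.
by case: (eqVneq a z) => //= _ aX; apply: gK.
Qed.

Lemma definable_sum (Pred : finType) n (S : 'I_n -> {set Pred}) X z f :
  definable S (z :: X) f ->
  definable S X (fun M g => \sum_(d : M) f M (upd g [:: z] [:: d]))%R.
Proof.
move=> df R K.
(* One function for each parameter that [z] may repeat, and then one for each type that a fresh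
   object may have. *)
have [Pold oldP] := choice (fun y =>
  df (fun a b => R (redirect z y a) (redirect z y b)) (K \o redirect z y)).
have [Pnew newP] := choice (fun J : {set Pred} =>
  df (fun a b => if a == z then b == z else if b == z then false else R a b)
     (fun a => if a == z then J else K a)).
(* [Y] names each parameter value once, so [C J] counts the distinct parameter values of type
   [J]. *)
pose Y := reps R X.
pose C J := count (fun y => K y == J) Y.
exists (fun v => \sum_(y <- Y) Pold y v +
  \sum_J ((\sum_(i | S i == J) Posz (v i)) - Posz (C J)) * Pnew J v)%R.
split.
  apply: piecewiseD; first by apply: piecewise_sum => y; case: (oldP y).
  apply: piecewise_sum => J; apply: piecewiseM; last by case: (newP J).
  apply: piecewiseB; last exact: piecewise_nat.
  by apply: piecewise_sum => i; apply: PiecewisePoly; apply: polynomialX.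
move=> v M g pr co.
rewrite (bigID (fun d => d \in map g X)) /=; congr (_ + _)%R.
  under eq_bigl do rewrite -mem_undup.
  rewrite -big_uniq ?undup_uniq //= (undup_map_reps co) big_map.
  apply: eq_big_seq => y /reps_subset yX; have [_] := oldP y; apply=> //.
  exact: compatible_old.
(* Fresh objects are grouped by type; those of one type all contribute the same value. *)
rewrite (partition_big (@obj_type Pred M) predT) //=.
apply: eq_bigr => J _.
rewrite (eq_bigr (fun=> Pnew J v)); last first.
  move=> d /andP[dX /eqP dJ]; have [_] := newP J; apply=> //.
  by rewrite -dJ; apply: compatible_new.
rewrite sumr_const -[LHS]mulr_natl; congr (_ * _)%R.
have -> : C J = #|[predI [set d : M | obj_type d == J] & [in map g X]]|.
  rewrite /C -(eq_in_count (a1 := fun y => obj_type (g y) == J)); last first.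
    by move=> y /reps_subset yX; rewrite co.2.
  rewrite -(count_map g (fun d => obj_type d == J)) -(undup_map_reps co).
  rewrite -size_filter -(card_uniqP _); last by rewrite filter_uniq ?undup_uniq.
  by apply: eq_card => d; rewrite mem_filter mem_undup !inE.
have -> : (\sum_(i | S i == J) Posz (v i))%R = Posz (state_card M J).
  by rewrite pr (big_morph Posz PoszD (erefl _)).
rewrite state_cardE natz -(cardID [in map g X] [set d : M | obj_type d == J]).
rewrite PoszD [(Posz _ + _)%R]addrC addrK; congr Posz.
by apply: eq_card => d; rewrite !inE.
Qed.

Lemma definable_count (Pred : finType) n (S : 'I_n -> {set Pred}) X x a :
  uniq x -> definable S (x ++ X) (fun M g => Posz (eval a g)) ->
  definable S X (fun M g => Posz (tuple_count x a g)).
Proof.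
elim: x X => [|z x IHx] X /=.
  move=> _ da R K; have [P [pP E]] := da R K; exists P; split=> // v M g *.
  by rewrite tuple_count_nil; apply: E.
case/andP => zx ux da.
have dz : definable S (z :: X) (fun M g => Posz (tuple_count x a g)).
  apply: IHx => //; apply: definable_mono da => y.
  by rewrite !(inE, mem_cat) orbCA.
move=> R K; have [P [pP E]] := definable_sum dz R K.
exists P; split=> // v M g pr co; rewrite -(E v M g pr co) tuple_count_cons //.
by rewrite (big_morph Posz PoszD (erefl _)).
Qed.

Lemma definable_ext (Pred : finType) n (S : 'I_n -> {set Pred}) X f1 f2 :
  (forall M g, f1 M g = f2 M g) -> definable S X f1 -> definable S X f2.
Proof.
move=> E d R K; have [P [pP f1P]] := d R K.
by exists P; split=> // v M g pr co; rewrite -E; apply: f1P.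
Qed.

Lemma definable_nat (Pred : finType) n (S : 'I_n -> {set Pred}) X k :
  definable S X (fun M g => Posz k).
Proof. by move=> R K; exists (fun=> Posz k); split=> //; apply: piecewise_nat. Qed.

Lemma definable_le (Pred : finType) n (S : 'I_n -> {set Pred}) X f1 f2 :
  definable S X f1 -> definable S X f2 ->
  definable S X (fun M g => Posz (f1 M g <= f2 M g)%R).
Proof.
by apply: (definable_map2 (op := fun a b => Posz (a <= b)%R)) => P Q; apply: piecewise_le.
Qed.

(** The pattern decides the atoms. As truth values are 0 or 1, connectives become comparisons:
    negation is [a <= 0], conjunction [1 <= a * b], disjunction [1 <= a + b]. An existential bounds
    a sum over objects below by 1; a universal bounds the sum of the negations above by 0. *)
Lemma definable_eval (Pred : finType) n (S : 'I_n -> {set Pred}) X a :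
  {subset fv a <= X} -> definable S X (fun M g => Posz (eval a g)).
Proof.
have fvU Z (s t : seq nat) : {subset s ++ t <= Z} -> {subset s <= Z} /\ {subset t <= Z}.
  by move=> h; split=> y ys; apply: h; rewrite mem_cat ys ?orbT.
have fvX (x s Z : seq nat) : {subset [seq z <- s | z \notin x] <= Z} ->
    {subset s <= x ++ Z}.
  move=> h y ys; rewrite mem_cat; case: (boolP (y \in x)) => //= yx.
  by apply: h; rewrite mem_filter yx.
have fvx x (s Z : seq nat) : {subset [seq z <- s | z != x] <= Z} ->
    {subset s <= x :: Z}.
  move=> h; apply: (fvX [:: x]) => y; rewrite mem_filter inE => xy.
  by apply: h; rewrite mem_filter.
elim: a X => /=.
- by move=> X _; apply: definable_nat.
- move=> Q x X sX R K; exists (fun=> Posz (Q \in K x)).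
  split; first exact: piecewise_nat.
  by move=> v M g pr [_ gK]; rewrite -gK ?sX ?inE.
- move=> x y X sX R K; exists (fun=> Posz (R x y)).
  split; first exact: piecewise_nat.
  by move=> v M g pr [gR _]; rewrite -gR ?sX ?inE ?eqxx ?orbT.
- move=> a IHa X sX.
  apply: definable_ext (definable_le (IHa X sX) (definable_nat S X 0)) => M g.
  by case: (eval a g).
- move=> a IHa b IHb X /fvU[sa sb].
  apply: definable_ext (definable_le (definable_nat S X 1)
    (definable_map2 (@piecewiseM n) (IHa X sa) (IHb X sb))) => M g.
  by case: (eval a g); case: (eval b g).
- move=> a IHa b IHb X /fvU[sa sb].
  apply: definable_ext (definable_le (definable_nat S X 1)
    (definable_map2 (@piecewiseD n) (IHa X sa) (IHb X sb))) => M g.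
  by case: (eval a g); case: (eval b g).
- move=> x a IHa X /fvx sX.
  apply: definable_ext (definable_le (definable_nat S X 1)
    (definable_sum (IHa _ sX))) => M g.
  rewrite -(big_morph Posz PoszD (erefl _)) lez_nat lt0n sum_nat_eq0.
  rewrite negb_forall; congr (Posz (nat_of_bool _)).
  by apply: eq_existsb => d; rewrite eqb0 negbK.
- move=> x a IHa X /fvx sX.
  have IHn : definable S (x :: X) (fun M g => Posz (~~ eval a g)).
    apply: definable_ext (definable_le (IHa _ sX) (definable_nat S _ 0)) => M g.
    by case: (eval a g).
  apply: definable_ext (definable_le (definable_sum IHn) (definable_nat S X 0)) => M g.
  rewrite -(big_morph Posz PoszD (erefl _)) lez_nat leqn0 sum_nat_eq0.
  congr (Posz (nat_of_bool _)).
  by apply: eq_forallb => d; rewrite eqb0 negbK.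
- move=> x a IHa y b IHb X /fvU[/fvX sa /fvX sb].
  exact: definable_le (definable_count (vars_uniq y) (IHb _ sb))
    (definable_count (vars_uniq x) (IHa _ sa)).
Qed.

(** * From sentences to Boolean combinations *)

Lemma profile_model (Pred : finType) n (S : 'I_n -> {set Pred}) (v : {ffun 'I_n -> nat}) :
  v != [ffun=> 0] -> exists M : finmodel Pred, profile S v M.
Proof.
(* The domain is the disjoint union of blocks of [v i] objects of type [S i]; it is nonempty because
   [v] is not 0. *)
move=> v0; pose T : finType := {i : 'I_n & 'I_(v i)}.
have cardT (A : pred 'I_n) : #|[set d : T | A (tag d)]| = \sum_(i | A i) v i.
  rewrite -sum1dep_card.
  transitivity (\sum_(i | A i) \sum_(j : 'I_(v i)) 1); last first.
    by apply: eq_bigr => i _; rewrite sum1_card card_ord.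
  by rewrite sig_big_dep /=; apply: eq_bigl => d; rewrite andbT.
have T0 : 0 < #|T|.
  rewrite lt0n; apply: contraNneq v0 => T0; apply/eqP/ffunP => i; rewrite ffunE.
  apply/eqP; rewrite -leqn0 -T0 -cardsT.
  have -> : [set: T] = [set d : T | predT (tag d)] by apply/setP => d; rewrite !inE.
  by rewrite cardT (bigD1 i) //= leq_addr.
exists (FinModel T0 (fun P => [set d : T | P \in S (tag d)])) => J.
rewrite state_cardE -cardT; apply: eq_card => d; rewrite !inE.
by congr (_ == J); apply/setP => P; rewrite !inE.
Qed.

Lemma profile_card (Pred : finType) n (S : 'I_n -> {set Pred}) v (M : finmodel Pred) :
  injective S -> profile S v M -> [ffun i => state_card M (S i)] = v.
Proof.
move=> S_inj pr; apply/ffunP => i; rewrite ffunE pr (eq_bigl (pred1 i)) ?big_pred1_eq //.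
by move=> j; rewrite /= (inj_eq S_inj).
Qed.

Lemma solution_dirac n (u : {ffun 'I_n -> nat}) :
  exists b : bool_dioph n, forall v, solution b v = (v == u).
Proof.
suff [b bE] : exists b : bool_dioph n,
    forall v, solution b v = all (fun i => v i == u i) (enum 'I_n).
  exists b => v; rewrite bE; apply/allP/eqP => [h|-> //].
  by apply/ffunP => i; apply/eqP/h; rewrite mem_enum.
elim: (enum 'I_n) => [|i s [b bE]].
  (* The empty conjunction is expressed by an inequality that always holds. *)
  by have [b bE] := polynomial_ge0 (polynomial_nat n 0); exists b => v; rewrite bE.
have pX := PiecewisePoly (polynomialX i); have pu := piecewise_nat n (u i).
have [b1 b1E] := piecewise_ge0 (piecewiseB pX pu).
have [b2 b2E] := piecewise_ge0 (piecewiseB pu pX).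
exists (BAnd (BAnd b1 b2) b) => v /=.
by rewrite bE b1E b2E !subr_ge0 !lez_nat -eqn_leq eq_sym.
Qed.

Lemma sentence_solution (Pred : finType) n (S : 'I_n -> {set Pred}) a :
  sentence a -> exists b : bool_dioph n,
    forall v M, profile S v M -> models M a <-> solution b v.
Proof.
move=> /nilP fva; have sub : {subset fv a <= [::]} by rewrite fva.
(* A sentence has no parameters, so every pattern is compatible and an arbitrary one is chosen. *)
have [P [pP E]] := definable_eval S sub (fun _ _ => false) (fun=> set0).
have evalE v (M : finmodel Pred) (g : nat -> M) : profile S v M -> Posz (eval a g) = P v.
  by move=> pr; apply: E.
have [b bE] := piecewise_ge0 (piecewiseB pP (piecewise_nat n 1)).
exists b => v M pr; rewrite bE subr_ge0; split=> [h|h g].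
  have /card_gt0P[d _] := dom_gt0 M.
  by rewrite -(evalE v M (fun=> d)) // h.
by move: h; rewrite -(evalE v M g) //; case: (eval a g).
Qed.

(** * Polynomials as numbers of tuples *)

(** Variables 0 and 1 are reserved for the tags; the decreasing order puts the new variable of a
    longer block in front. *)
Definition block (L : nat) : seq nat := rev (iota 2 L).

Lemma blockS L : block L.+1 = L.+2 :: block L.
Proof. by rewrite /block -[in iota 2 _](addn1 L) iotaD rev_cat add2n. Qed.

Lemma mem_block L z : (z \in block L) = (1 < z < L.+2).
Proof. by rewrite mem_rev mem_iota addnC addn2. Qed.

Lemma block_uniq L : uniq (block L).
Proof. by rewrite rev_uniq iota_uniq. Qed.

Lemma block_gt0 L : 0 < size (block L.+1).
Proof. by rewrite size_rev size_iota. Qed.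

Lemma fv_type_at (Pred : finType) (J : {set Pred}) z : {subset fv (type_at J z) <= [:: z]}.
Proof.
have fvb (A : {set Pred}) F : (forall P, {subset fv (F P) <= [:: z]}) ->
    {subset fv (\big[@FAnd Pred/FTop]_(P in A) F P) <= [:: z]}.
  move=> h; apply: (big_ind (fun a => {subset fv a <= [:: z]})) => // a b ha hb y.
  by rewrite /= mem_cat => /orP[/ha|/hb].
by move=> y; rewrite /= mem_cat => /orP[]; apply: fvb => P w.
Qed.

(** The count is the same for all pairs of distinct tags. The bound on free variables leaves only
    the tags free once the block is counted over. *)
Definition counted_by (Pred : finType) (L : nat)
    (h : finmodel Pred -> nat) : Prop :=
  exists psi : formula Pred, {subset fv psi <= gtn L.+2} /\
    forall (M : finmodel Pred) (g : nat -> M),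
      g 0 != g 1 -> tuple_count (block L) psi g = h M.

Lemma upd_notin (T : Type) (g : nat -> T) x (t : seq T) z :
  z \notin x -> size t = size x -> upd g x t z = g z.
Proof. by move=> zx st; rewrite /upd nth_default // st (memNindex zx). Qed.

(** Given the tags, [theta] depends only on the leading variable, so it restricts that variable to
    [A] before the rest is counted. *)
Lemma tuple_count_guard (Pred : finType) L (M : finmodel Pred) psi theta
    (g : nat -> M) (A : pred M) :
  (forall h : nat -> M, h 0 = g 0 -> h 1 = g 1 -> eval theta h = A (h L.+2)) ->
  tuple_count (block L.+1) (FAnd theta psi) g =
  \sum_(d | A d) tuple_count (block L) psi (upd g [:: L.+2] [:: d]).
Proof.
move=> thetaE; have zL : L.+2 \notin block L by rewrite mem_block ltnn andbF.
rewrite blockS tuple_count_cons // [RHS]big_mkcond; apply: eq_bigr => d _.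
have nb z (t : (size (block L)).-tuple M) : z \notin block L ->
    upd (upd g [:: L.+2] [:: d]) (block L) t z = if z == L.+2 then d else g z.
  by move=> zb; rewrite upd_notin ?size_tuple // updE.
rewrite /tuple_count; case: ifP => Ad; [apply: eq_card|apply: eq_card0] => t; rewrite !inE /=.
all: by rewrite thetaE ?nb ?eqxx ?Ad // mem_block.
Qed.

(** The leading variable equals tag 0 in one disjunct and tag 1 in the other. Distinct tags make the
    disjuncts exclusive, so the counts add up. *)
Lemma counted_byD (Pred : finType) L (h1 h2 : finmodel Pred -> nat) :
  counted_by L h1 -> counted_by L h2 ->
  counted_by L.+1 (fun M => h1 M + h2 M).
Proof.
move=> [psi1 [fv1 E1]] [psi2 [fv2 E2]].
exists (FOr (FAnd (FEq L.+2 0) psi1) (FAnd (FEq L.+2 1) psi2)); split.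
  move=> z /=; rewrite !(mem_cat, inE) /= -?orbA.
  case/or3P => [/eqP -> //|/eqP -> //|/orP[/fv1|/or3P[/eqP -> //|/eqP -> //|/fv2]]].
  1-2: by rewrite unfold_in => /ltnW.
move=> M g g01.
have -> : tuple_count (block L.+1)
    (FOr (FAnd (FEq L.+2 0) psi1) (FAnd (FEq L.+2 1) psi2)) g =
  tuple_count (block L.+1) (FAnd (FEq L.+2 0) psi1) g +
  tuple_count (block L.+1) (FAnd (FEq L.+2 1) psi2) g.
  rewrite /tuple_count -cardsUI [X in _ + X](_ : _ = 0) ?addn0.
    by apply: eq_card => t; rewrite !inE.
  apply: eq_card0 => t; rewrite !inE /=.
  rewrite !(@upd_notin _ _ _ _ 0, @upd_notin _ _ _ _ 1) ?mem_block ?size_tuple //.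
  by apply: contraNF g01 => /andP[/andP[/eqP <- _] /andP[/eqP <- _]].
rewrite (tuple_count_guard _ (A := pred1 (g 0))); last by move=> h gh _ /=; rewrite gh.
rewrite (tuple_count_guard _ (A := pred1 (g 1))); last by move=> h _ gh /=; rewrite gh.
by rewrite !big_pred1_eq E1 ?E2 ?updE.
Qed.

(** Adding zero lengthens the block, which allows two counts to be brought to a common length. *)
Lemma counted_by_pad (Pred : finType) L (h : finmodel Pred -> nat) :
  counted_by L h -> counted_by L.+1 h.
Proof.
move=> ch; suff c0 : counted_by L (fun _ : finmodel Pred => 0).
  have [psi [fvp E]] := counted_byD ch c0.
  by exists psi; split=> // M g g01; rewrite E // addn0.
exists (FNot FTop); split=> // M g _.
by apply: eq_card0 => t; rewrite inE.
Qed.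

(** The leading variable ranges over the objects of type [J], each followed by [h M] tuples. *)
Lemma counted_by_type (Pred : finType) L (J : {set Pred}) (h : finmodel Pred -> nat) :
  counted_by L h -> counted_by L.+1 (fun M => state_card M J * h M).
Proof.
move=> [psi [fvp E]]; exists (FAnd (type_at J L.+2) psi); split.
  move=> z; rewrite [fv _]/= mem_cat => /orP[/fv_type_at|/fvp].
    by rewrite inE => /eqP ->; rewrite unfold_in /=.
  by rewrite !unfold_in /= => /ltnW.
move=> M g g01.
rewrite (tuple_count_guard _ (A := fun d => obj_type d == J)); last first.
  by move=> h' _ _; rewrite eval_type_at.
rewrite (eq_bigr (fun=> h M)); last by move=> d _; rewrite E ?updE.
rewrite sum_nat_const state_cardE; congr (_ * _).
by apply: eq_card => d; rewrite !inE.
Qed.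

Lemma counted_by_leq (Pred : finType) L L' (h : finmodel Pred -> nat) :
  L <= L' -> counted_by L h -> counted_by L' h.
Proof.
move=> /subnK <- ch; elim: (L' - L) => //= k; exact: counted_by_pad.
Qed.

Definition counted (Pred : finType) (h : finmodel Pred -> nat) : Prop :=
  exists L, counted_by L h.

Lemma counted_eq (Pred : finType) (h h' : finmodel Pred -> nat) :
  h =1 h' -> counted h -> counted h'.
Proof. by move=> /funext <-. Qed.

(** The empty block has exactly one tuple. *)
Lemma counted_bool (Pred : finType) (c : bool) : counted (fun _ : finmodel Pred => c).
Proof.
exists 0; exists (if c then FTop else FNot FTop); split; first by case: c.
by move=> M g _; rewrite tuple_count_nil; case: c.
Qed.

Lemma countedD (Pred : finType) (h1 h2 : finmodel Pred -> nat) :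
  counted h1 -> counted h2 -> counted (fun M => h1 M + h2 M).
Proof.
move=> [L1 c1] [L2 c2]; exists (maxn L1 L2).+1.
by apply: counted_byD; [apply: counted_by_leq c1|apply: counted_by_leq c2];
  rewrite ?leq_maxl ?leq_maxr.
Qed.

Lemma counted_type (Pred : finType) J (h : finmodel Pred -> nat) :
  counted h -> counted (fun M => state_card M J * h M).
Proof. by move=> [L c]; exists L.+1; apply: counted_by_type. Qed.

(** The coefficient comes from repeated addition, each power from repeated multiplication by the
    size of a type. *)
Lemma counted_monomial (Pred : finType) n (S : 'I_n -> {set Pred}) (m : monomial n) :
  counted (fun M => monomial_eval [ffun i => state_card M (S i)] m).
Proof.
suff [h ch hE] : exists2 h : finmodel Pred -> nat, counted h &
    forall M, h M = \prod_(i < n) [ffun i => state_card M (S i)] i ^ expo m i.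
  rewrite /monomial_eval; elim: (coef m) => [|k IHk].
    by apply: counted_eq (counted_bool Pred false) => M.
  by apply: counted_eq (countedD ch IHk) => M; rewrite mulSn hE.
elim: (index_enum _) => [|i s [h ch hE]].
  by exists (fun=> true) => [|M]; [exact: counted_bool|rewrite big_nil].
exists (fun M => state_card M (S i) ^ expo m i * h M) => [|M].
  elim: (expo m i) => [|k IHk]; first by apply: counted_eq ch => M; rewrite mul1n.
  by apply: counted_eq (counted_type (S i) IHk) => M; rewrite expnS mulnA.
by rewrite big_cons hE ffunE.
Qed.

Lemma counted_poly (Pred : finType) n (S : 'I_n -> {set Pred}) (p : seq (monomial n)) :
  counted (fun M => poly_eval p [ffun i => state_card M (S i)]).
Proof.
elim: p => [|m p IHp].
  by apply: counted_eq (counted_bool Pred false) => M; rewrite /poly_eval big_nil.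
apply: counted_eq (countedD (counted_monomial S m) IHp) => M.
by rewrite /poly_eval big_cons.
Qed.

(** * From Boolean combinations to sentences *)

Lemma solution_formula (Pred : finType) n (S : 'I_n -> {set Pred}) (b : bool_dioph n) :
  exists a : formula Pred, {subset fv a <= gtn 2} /\
    forall (M : finmodel Pred) (g : nat -> M), g 0 != g 1 ->
      eval a g = solution b [ffun i => state_card M (S i)].
Proof.
elim: b => [e|b [a [fva E]]|b [a [fva E]] b' [a' [fva' E']]|b [a [fva E]] b' [a' [fva' E']]].
(* Padding makes each block nonempty, as a counting operator requires. *)
- have [Ll /counted_by_pad[l [fvl lE]]] := counted_poly S (lhs e).
  have [Lr /counted_by_pad[r [fvr rE]]] := counted_poly S (rhs e).
  exists (FCount (VarSeq (block_uniq Ll.+1) (block_gt0 Ll)) l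
                 (VarSeq (block_uniq Lr.+1) (block_gt0 Lr)) r); split.
    move=> z; rewrite /= mem_cat !mem_filter !mem_block => /orP[]/andP[zb].
      by move/fvl; rewrite !unfold_in /= => zl; move: zb; rewrite zl andbT -leqNgt.
    by move/fvr; rewrite !unfold_in /= => zr; move: zb; rewrite zr andbT -leqNgt.
  by move=> M g g01; rewrite /= /dioph_holds -!/(poly_eval _ _) -(lE M g g01) -(rE M g g01).
- by exists (FNot a); split=> // M g g01 /=; rewrite E.
- exists (FAnd a a'); split=> [z|M g g01 /=]; last by rewrite E ?E'.
  by rewrite /= mem_cat => /orP[/fva|/fva'].
- exists (FOr a a'); split=> [z|M g g01 /=]; last by rewrite E ?E'.
  by rewrite /= mem_cat => /orP[/fva|/fva'].
Qed.

Lemma solution_sentence (Pred : finType) n (S : 'I_n -> {set Pred}) (b : bool_dioph n) :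
  exists a : formula Pred, sentence a /\
    forall M : finmodel Pred, models M a <-> solution b [ffun i => state_card M (S i)].
Proof.
have [chi [fvchi chiE]] := solution_formula S b.
(* The truth value of [b] in a one-element model of type [J] is that at the
   indicator vector of [J]. *)
pose tau : formula Pred := \big[@FOr Pred/FNot FTop]_(J : {set Pred} |
  solution b [ffun i => (S i == J) : nat]) type_at J 0.
have fvtau : {subset fv tau <= [:: 0]}.
  apply: (big_ind (fun a => {subset fv a <= [:: 0]})) => // [a a' ha ha' y|J _].
    by rewrite /= mem_cat => /orP[/ha|/ha'].
  exact: fv_type_at.
have tauE (M : finmodel Pred) (g : nat -> M) :
    eval tau g = solution b [ffun i => (S i == obj_type (g 0)) : nat].
  rewrite (big_morph (fun a => eval a g) (id1 := false) (op1 := orb)) // big_orE.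
  apply/existsP/idP => [[J /andP[sJ]]|s]; first by rewrite eval_type_at => /eqP ->.
  by exists (obj_type (g 0)); rewrite s eval_type_at /=.
pose many : formula Pred := FEx 1 (FNot (FEq 0 1)).
(* With variable 0 as first tag, [chi] must hold for every different second tag; if there is none,
   [tau] decides. *)
pose body := FAnd (FAll 1 (FOr (FEq 0 1) chi)) (FOr many tau).
have fvbody : {subset fv body <= [:: 0]}.
  move=> z; rewrite /body /= !(inE, mem_cat, mem_filter) -?orbA.
  case/or4P => // [/andP[z1 /fvchi]|/fvtau]; last by rewrite inE.
    by rewrite unfold_in /=; case: z z1 => [|[|z]].
exists (FAll 0 body); split.
  rewrite /sentence /nilp size_filter -leqn0 leqNgt -has_count -all_predC.
  by apply/allP => z /fvbody; rewrite inE /= negbK.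
move=> M; set v := [ffun i => _].
(* In a one-element model the vector of cardinalities is the indicator of the only type. *)
have vE (d0 : M) : (forall d : M, d = d0) ->
    [ffun i => (S i == obj_type d0) : nat] = v.
  move=> M1; apply/ffunP => i; rewrite !ffunE state_cardE.
  case: (eqVneq (S i) (obj_type d0)) => [e|ne].
    rewrite (_ : [set _ | _] = [set d0]) ?cards1 //.
    by apply/setP => d; rewrite !inE (M1 d) e !eqxx.
  by symmetry; apply: eq_card0 => d; rewrite inE (M1 d) eq_sym (negPf ne).
have /card_gt0P[d0 _] := dom_gt0 M.
have bodyE (g : nat -> M) d : eval body (upd g [:: 0] [:: d]) =
    [forall d', (d == d') || eval chi (upd (upd g [:: 0] [:: d]) [:: 1] [:: d'])] &&
    ([exists d', d != d'] || solution b [ffun i => (S i == obj_type d) : nat]).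
  rewrite /body [LHS]/= -/(eval tau _) tauE updE; congr (_ && (_ || _)).
split=> [all_g|s g].
  have : eval body (upd (fun=> d0) [:: 0] [:: d0]).
    by have /forallP := all_g (fun=> d0); apply.
  rewrite bodyE => /andP[/forallP h /orP[/existsP[d1 d01]|]].
    by have /orP[|] := h d1; rewrite ?(negPf d01) ?chiE ?updE.
  (* [tau] is conclusive only on a one-element domain; otherwise a second object again serves as
     tag. *)
  case: (boolP [forall d : M, d == d0]) => [/forallP M1|].
    by rewrite vE // => d; apply/eqP.
  rewrite negb_forall => /existsP[d1 d10] _; rewrite eq_sym in d10.
  by have /orP[|] := h d1; rewrite ?(negPf d10) ?chiE ?updE.
apply/forallP => d; suff: eval body (upd g [:: 0] [:: d]) by [].
rewrite bodyE; apply/andP; split.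
  by apply/forallP => d1; case: (eqVneq d d1) => //= dd; rewrite chiE ?updE.
case: (boolP [exists d', d != d']) => //=.
rewrite negb_exists => /forallP M1.
by rewrite vE // => d'; have /negPn/eqP := M1 d'.
Qed.

Theorem theorem5p7 (Pred : finType) (n : nat) (S : 'I_n -> {set Pred})
    (S_inj : injective S) (V : {ffun 'I_n -> nat} -> Prop) :
  (exists phi : formula Pred,
     sentence phi /\
     forall M : finmodel Pred,
       models M phi <-> V [ffun i => state_card M (S i)]) <->
  (exists b : bool_dioph n,
     forall v : {ffun 'I_n -> nat}, V v <-> solution b v).
Proof.
split=> [[phi [sphi phiE]]|[b bE]]; last first.
  have [a [sa aE]] := solution_sentence S b.
  by exists a; split=> // M; rewrite aE bE.
have [b bE] := sentence_solution S sphi.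
have [b0 b0E] := solution_dirac ([ffun=> 0] : {ffun 'I_n -> nat}).
have VE v : v != [ffun=> 0] -> V v <-> solution b v.
  move=> /(profile_model S)[M pr].
  by rewrite -(bE v M pr) phiE (profile_card S_inj pr).
(* No model has profile 0, its domain being nonempty; the origin is added to or removed from the
   solutions by a classical case distinction. *)
case: (pselect (V [ffun=> 0])) => V0.
  exists (BOr b0 b) => v /=; rewrite b0E.
  by case: (eqVneq v [ffun=> 0]) => [->|/VE].
exists (BAnd (BNot b0) b) => v /=; rewrite b0E.
by case: (eqVneq v [ffun=> 0]) => [->|/VE].
Qed.
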